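(* There exist sets $\mathsf{P}_{\ast}\in\mathcal{C}$ and $\mathsf{P}_{j}\in\mathcal{C}$ ($j=1,2,3,\dots$) with $\mathsf{P}_{j}\to\mathsf{P}_{\ast}$ in $\mathcal{C}$ as $j\to\infty$ such that $$\mathcal{G}^{\times}(\mathsf{P}_{j};\mathcal{F})\neq\{\varnothing\}\quad\text{for every } j,\qquad\text{but}\qquad \mathcal{G}^{\times}(\mathsf{P}_{\ast};\mathcal{F})=\{\varnothing\}.$$ In this sense the class of inadmissible velocities $\mathcal{G}^{\times}(\,\cdot\,;\mathcal{F})$ is unstable with respect to convergence in $\mathcal{C}$.
   Context: $\mathscr{L}_{2}$ is Lebesgue measure on $\mathbb{R}^{2}$. $\mathcal{C}$ is the class of all compact, connected subsets of $\mathbb{R}^{2}$ whose boundaries admit the structure of a real-analytic manifold, with the topology generated by the Hausdorff distance. $\mathbb{T}^{2}$ is the 2-torus of pairs of angles $\beta=(\theta,\psi)$ modulo $2\pi$; $R(\theta)\in\mathrm{SO}(2)$ is rotation by angle $\theta$ and $e(\psi)=(\cos\psi,\sin\psi)$. For $\mathsf{P}\in\mathcal{C}$ and $\beta=(\theta,\psi)$ the distance of closest approach is $$d_{\beta}:=\inf\{d>0:\mathscr{L}_{2}(\mathsf{P}\cap(R(\theta)\mathsf{P}+d\,e(\psi)))=0\}.$$ For $V=[v,\overline{v},\omega,\overline{\omega}]\in L^{1}_{\mathrm{loc}}(\mathbb{R},\mathbb{R}^{6})$ (with $v,\overline{v}$ valued in $\mathbb{R}^{2}$ and $\omega,\overline{\omega}$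 valued in $\mathbb{R}$) set $$x(t)=\int_{0}^{t}v\,ds,\quad \overline{x}(t)=d_{\beta}e(\psi)+\int_{0}^{t}\overline{v}\,ds,\quad \vartheta(t)=\int_{0}^{t}\omega\,ds,\quad \overline{\vartheta}(t)=\theta+\int_{0}^{t}\overline{\omega}\,ds,$$ and $\mathsf{P}(t)=R(\vartheta(t))\mathsf{P}+x(t)$, $\overline{\mathsf{P}}(t)=R(\overline{\vartheta}(t))\mathsf{P}+\overline{x}(t)$. The germ at $0$ of $V$ is $[V]_{0}:=\{W\in L^{1}_{\mathrm{loc}}(\mathbb{R},\mathbb{R}^{6}): W=V \text{ a.e. on }(-\delta,\delta)\text{ for some }\delta>0\}$. The inadmissible velocity maps $\widetilde{\Sigma}_{\beta}^{\times}(\mathsf{P})$ are those $V\in L^{1}_{\mathrm{loc}}(\mathbb{R},\mathbb{R}^{6})$ for which there is an open interval $\mathcal{N}\ni 0$ with $\mathscr{L}_{2}(\mathsf{P}(t)\cap\overline{\mathsf{P}}(t))>0$ for all $t\in\mathcal{N}\setminus\{0\}$. $\mathcal{F}=\mathcal{F}(\mathbb{R},\mathbb{R}^{6})$ is the space of $V\in L^{1}_{\mathrm{loc}}(\mathbb{R},\mathbb{R}^{6})$ that are a.e. equal to a constant vector. Put $G^{\times}_{\beta}(\mathsf{P};\mathcal{F}):=\{[V]_{0}: V\in\mathcal{F}\cap\widetilde{\Sigma}^{\times}_{\beta}(\mathsf{P})\}$ and $\mathcal{G}^{\times}(\mathsf{P};\mathcal{F}):=\{G^{\times}_{\beta}(\mathsf{P};\mathcal{F}):\beta\in\mathbb{T}^{2}\}$.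 Thus $\mathcal{G}^{\times}(\mathsf{P};\mathcal{F})=\{\varnothing\}$ means $G_{\beta}^{\times}(\mathsf{P};\mathcal{F})=\varnothing$ for every $\beta\in\mathbb{T}^{2}$. *)

(* Defs.v *)
From HB Require Import structures.
From mathcomp Require Import all_boot all_order all_algebra.
From mathcomp Require Import all_classical all_reals all_analysis.

Set Implicit Arguments.
Unset Strict Implicit.
Unset Printing Implicit Defensive.

Import Order.TTheory GRing.Theory Num.Theory.
Import numFieldNormedType.Exports.

Local Open Scope classical_set_scope.
Local Open Scope ring_scope.

Section Particles.
Variable R : realType.

(* The plane is R * R: its library topology and its Borel sets are the usual
   ones, but its library norm is the max norm, so the Euclidean distance is
   introduced separately. *)

Definition area : set (R * R) -> \bar R :=
  (@lebesgue_measure R \x @lebesgue_measure R)%E.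

Definition edist2 (x y : R * R) : R :=
  Num.sqrt ((x.1 - y.1) ^+ 2 + (x.2 - y.2) ^+ 2).

Definition dist_to_set (x : R * R) (A : set (R * R)) : R :=
  inf [set edist2 x y | y in A].

(* Meaningful for nonempty bounded sets, in particular on [classC] below. *)
Definition hausdorff_dist (A B : set (R * R)) : R :=
  Num.max (sup [set dist_to_set a B | a in A])
          (sup [set dist_to_set b A | b in B]).

Definition boundary (P : set (R * R)) : set (R * R) := closure P `\` interior P.

Definition real_analytic_at (f : R -> R) (t0 : R) : Prop :=
  exists (a : nat -> R) (r : R), 0 < r /\
    forall t, `|t - t0| < r -> pseries a (t - t0) @ \oo --> f t.

(* Embedded one-dimensional real-analytic submanifold of the plane: near each
   of its points, M is the image of an open subset I of the line under a
   real-analytic immersion gam that is a homeomorphism onto M `&` U, with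
   inverse chart g. Transition maps between such charts are then automatically
   real-analytic. *)
Definition analytic_curve (M : set (R * R)) : Prop :=
  forall p, M p ->
    exists (U : set (R * R)) (I : set R) (gam : R -> R * R) (g : R * R -> R),
      [/\ open U, U p & open I] /\
      [/\ forall t, I t -> real_analytic_at (fst \o gam) t /\
                           real_analytic_at (snd \o gam) t,
          forall t, I t -> (derive1 (fst \o gam) t, derive1 (snd \o gam) t) != (0, 0),
          gam @` I = M `&` U,
          forall t, I t -> g (gam t) = t &
          {within M `&` U, continuous g}].

(* The empty set is excluded, as the Hausdorff distance requires. *)
Definition classC (P : set (R * R)) : Prop :=
  [/\ P !=set0, compact P, connected P & analytic_curve (boundary P)].

Definition rot (theta : R) (x : R * R) : R * R :=
  (cos theta * x.1 - sin theta * x.2, sin theta * x.1 + cos theta * x.2).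

Definition polar (d psi : R) : R * R := (d * cos psi, d * sin psi).

Definition move (theta : R) (x : R * R) (P : set (R * R)) : set (R * R) :=
  [set rot theta p + x | p in P].

(* The torus of pairs of angles modulo 2 pi, by its fundamental domain. *)
Definition torus2 : set (R * R) :=
  [set beta | 0 <= beta.1 < 2 * pi /\ 0 <= beta.2 < 2 * pi].

Definition closest_approach (P : set (R * R)) (beta : R * R) : R :=
  inf [set d : R | 0 < d /\
         area (P `&` move beta.1 (polar d beta.2) P) = 0%E].

(* Oriented integral from 0 to t, for t of either sign: at most one of the two
   terms is nonzero. *)
Definition int0 (f : R -> R) (t : R) : R :=
  (\int[@lebesgue_measure R]_(s in `[0, t]) f s)
  - (\int[@lebesgue_measure R]_(s in `[t, 0]) f s).

Definition velocity := R -> 'rV[R]_6.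

(* Elements of L^1_loc are represented by (Borel) functions. *)
Definition L1loc (V : velocity) : Prop :=
  forall k : 'I_6, locally_integrable setT (fun s => V s ord0 k).

(* V = [v, vbar, omega, omegabar] occupies the entries 0-1, 2-3, 4, 5. *)
Definition primitive (V : velocity) (k : 'I_6) (t : R) : R :=
  int0 (fun s => V s ord0 k) t.

Definition particle (P : set (R * R)) (V : velocity) (t : R) : set (R * R) :=
  move (primitive V (@Ordinal 6 4 isT) t)
       (primitive V (@Ordinal 6 0 isT) t, primitive V (@Ordinal 6 1 isT) t) P.

Definition particle_bar (P : set (R * R)) (beta : R * R) (V : velocity)
    (t : R) : set (R * R) :=
  move (beta.1 + primitive V (@Ordinal 6 5 isT) t)
       (polar (closest_approach P beta) beta.2
        + (primitive V (@Ordinal 6 2 isT) t, primitive V (@Ordinal 6 3 isT) t))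
       P.

Definition germ0 (V : velocity) : set velocity :=
  [set W | L1loc W /\ exists delta : R, 0 < delta /\
     {ae @lebesgue_measure R,
       forall s, - delta < s < delta -> W s = V s}].

Definition inadmissible (P : set (R * R)) (beta : R * R) : set velocity :=
  [set V | L1loc V /\ exists a b : R, [/\ a < 0, 0 < b &
     forall t, a < t < b -> t != 0 ->
       (0 < area (particle P V t `&` particle_bar P beta V t))%E]].

Definition constF : set velocity :=
  [set V | L1loc V /\
     exists c : 'rV[R]_6, {ae @lebesgue_measure R, forall s, V s = c}].

Definition inadmissible_germs (P : set (R * R)) (F : set velocity)
    (beta : R * R) : set (set velocity) :=
  [set germ0 V | V in F `&` inadmissible P beta].

Definition inadmissible_class (P : set (R * R)) (F : set velocity) :
    set (set (set velocity)) :=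
  [set inadmissible_germs P F beta | beta in torus2].

End Particles.
Arguments constF : clear implicits.

(* Main.v *)
Require Import Defs.
From mathcomp Require Import all_boot all_order all_algebra.
From mathcomp Require Import all_classical all_reals all_analysis.
From mathcomp Require Import measurable_realfun.
From mathcomp Require Import ring lra.

Set Implicit Arguments.
Unset Strict Implicit.
Unset Printing Implicit Defensive.

Import Order.TTheory GRing.Theory Num.Theory.
Import numFieldNormedType.Exports.
Local Open Scope classical_set_scope.
Local Open Scope ring_scope.

(** The limit particle is the unit disc centred at the origin, and the
    approximating particles are unit discs centred at (s, 0), where s > 0 tends
    to 0. All rotations are taken about the origin, so translating a particle
    changes the mechanics: rotating the first disc does not move it, while
    rotating a shifted disc makes its centre turn on a circle of radius s.

    Two unit discs overlap in positive area exactly when the squared distance of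
    their centres is less than 4 ([area_gt0_discs], [area0_discs]), so the
    distance of closest approach is 2 as soon as the centre is fixed by the
    rotation in question ([closest_approach_disc]).

    Centred disc. Under constant velocities the vector joining the two centres
    is 2 e + t w, with squared length 4 + 4 t (e . w) + t^2 |w|^2. On the side of
    t = 0 where t (e . w) >= 0 this is at least 4, so a constant velocity never
    makes the particles overlap both just before and just after time 0, whatever
    the angles are ([inadmissible_germs_disc0]).

    Shifted disc, both angles 0. Let the first particle rest and the second
    rotate about the origin at unit speed. Its centre (2 + s cos t, s sin t)
    accelerates towards the first particle, and the squared distance is
    4 - (4 s - 2 s^2) (1 - cos t), which is less than 4 for small t of either
    sign ([spin_bar_inadmissible]).

    The Hausdorff distance of two unit discs is at most the distance of their
    centres, because a translation carries one onto the other
    ([hausdorff_dist_disc]). *)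

(** * Real-analyticity of trigonometric functions *)

Section Analyticity.
Variable R : realType.

Lemma cvg_pseries_cos (x : R) :
  pseries (fun n => (~~ odd n)%:R * (-1) ^+ n./2 * n`!%:R^-1) x @ \oo --> cos x.
Proof.
by rewrite /pseries -cos_coeffE unlock; exact: is_cvg_series_cos_coeff.
Qed.

Lemma cvg_pseries_sin (x : R) :
  pseries (fun n => (odd n)%:R * (-1) ^+ n.-1./2 * n`!%:R^-1) x @ \oo --> sin x.
Proof.
by rewrite /pseries -sin_coeffE unlock; exact: is_cvg_series_sin_coeff.
Qed.

Lemma cvg_pseries_cst (a x : R) :
  pseries (fun n => if n is 0 then a else 0) x @ \oo --> a.
Proof.
apply/cvgrPdist_lt => e e0; near=> N.
have N0 : (0 < N)%N by near: N; exists 1%N.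
rewrite -(prednK N0) /pseries /series /= big_nat_recl //= expr0 mulr1 big1 ?addr0
  ?subrr ?normr0 //.
by move=> i _; rewrite mul0r.
Unshelve. all: by end_near.
Qed.

Lemma cvg_pseriesD (u v : nat -> R) (x l m : R) :
  pseries u x @ \oo --> l -> pseries v x @ \oo --> m ->
  pseries (fun n => u n + v n) x @ \oo --> l + m.
Proof.
move=> ul vm.
rewrite (_ : pseries _ x = pseries u x \+ pseries v x); first exact: cvgD.
apply/funext => N; rewrite /pseries /series /= -big_split /=.
by apply: eq_bigr => i _; rewrite mulrDl.
Qed.

Lemma cvg_pseriesZ (k : R) (u : nat -> R) (x l : R) :
  pseries u x @ \oo --> l -> pseries (fun n => k * u n) x @ \oo --> k * l.
Proof.
move=> ul.
rewrite (_ : pseries _ x = fun N => k * pseries u x N); first exact: cvgMr.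
apply/funext => N; rewrite /pseries /series /= mulr_sumr.
by apply: eq_bigr => i _; rewrite mulrA.
Qed.

(** The addition formulas reduce the expansion at an arbitrary point to the
    power series of cosine and sine at 0; such combinations are the coordinates
    of every parametrization of a circle by angle. *)
Lemma real_analytic_at_trig (a b c t0 : R) :
  real_analytic_at (fun t => a + (b * cos t + c * sin t)) t0.
Proof.
exists (fun n => (if n is 0 then a else 0) +
  ((b * cos t0 + c * sin t0) * ((~~ odd n)%:R * (-1) ^+ n./2 * n`!%:R^-1) +
   (c * cos t0 - b * sin t0) * ((odd n)%:R * (-1) ^+ n.-1./2 * n`!%:R^-1))), 1.
split => // t _.
rewrite [X in _ --> X](_ : _ = a + ((b * cos t0 + c * sin t0) * cos (t - t0) +
   (c * cos t0 - b * sin t0) * sin (t - t0))).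
  apply: cvg_pseriesD; first exact: cvg_pseries_cst.
  apply: cvg_pseriesD; apply: cvg_pseriesZ.
    exact: cvg_pseries_cos.
  exact: cvg_pseries_sin.
move: (t - t0) (esym (subrK t0 t)) => h ->.
by rewrite cosD sinD; ring.
Qed.

End Analyticity.

(** * Topology of the closed unit disc *)

Section Disc.
Variable R : realType.
Implicit Types (c x a b : R * R).

Definition sqdist x c : R := (x.1 - c.1) ^+ 2 + (x.2 - c.2) ^+ 2.

Definition disc c : set (R * R) := [set x | sqdist x c <= 1].

Lemma continuous_affine (u v w : R) :
  continuous (fun x : R * R => u * x.1 + v * x.2 + w).
Proof.
move=> x; apply: cvgD; last exact: cvg_cst.
by apply: cvgD; apply: cvgMr; [exact: cvg_fst|exact: cvg_snd].
Qed.

Lemma continuous_line (p1 p2 v1 v2 : R) :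
  continuous (fun t : R => (p1 + t * v1, p2 + t * v2)).
Proof.
move=> t; apply: (@cvg_pair R R R (nbhs t) (nbhs _) (nbhs _));
  by apply: cvgD; [exact: cvg_cst|apply: cvgMl; exact: cvg_id].
Qed.

Lemma continuous_sqdist c : continuous (sqdist^~ c).
Proof.
move=> x; rewrite /sqdist.
have h1 : (y.1 - c.1) @[y --> x] --> x.1 - c.1.
  by apply: cvgB; [exact: cvg_fst|exact: cvg_cst].
have h2 : (y.2 - c.2) @[y --> x] --> x.2 - c.2.
  by apply: cvgB; [exact: cvg_snd|exact: cvg_cst].
by apply: cvgD; rewrite expr2; under eq_fun do rewrite expr2; exact: cvgM.
Qed.

Lemma closed_disc c : closed (disc c).
Proof.
have /continuous_closedP/(_ _ (@closed_le R 1)) := @continuous_sqdist c.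
exact.
Qed.

Lemma measurable_disc c :
  measurable (disc c : set (measurableTypeR R * measurableTypeR R)).
Proof.
have mf : measurable_fun [set: measurableTypeR R * measurableTypeR R]
    (sqdist^~ c : _ -> measurableTypeR R).
  by apply: measurable_funD; apply: measurable_funX; apply: measurable_funB.
have := mf measurableT `]-oo, 1%R]%classic (measurable_itv _).
by rewrite setTI; congr (measurable _).
Qed.

Lemma sqr_norm_le1 (u : R) : (u ^+ 2 <= 1) = (`|u| <= 1).
Proof. by rewrite -real_normK ?num_real // expr_le1. Qed.

Lemma compact_disc c : compact (disc c).
Proof.
apply: (@subclosed_compact _ _
  (`[c.1 - 1, c.1 + 1]%classic `*` `[c.2 - 1, c.2 + 1]%classic)).
- exact: closed_disc.
- by apply: compact_setX; exact: segment_compact.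
- move=> x; rewrite /disc /sqdist /= !in_itv /= => h.
  have [h1 h2] : (x.1 - c.1) ^+ 2 <= 1 /\ (x.2 - c.2) ^+ 2 <= 1.
    by split; apply: le_trans h; rewrite ?lerDl ?lerDr sqr_ge0.
  by move: h1 h2; rewrite !sqr_norm_le1 !ler_distl => -> ->.
Qed.

(** A disc is the union of the segments that join its centre to its points. *)
Lemma connected_disc c : connected (disc c).
Proof.
pose seg x := (fun t : R => (c.1 + t * (x.1 - c.1), c.2 + t * (x.2 - c.2)))
              @` `[0, 1].
have -> : disc c = \bigcup_(x in disc c) seg x.
  apply/seteqP; split => [x dx|_ [x dx [t + <-]]].
    exists x => //; exists 1; first by rewrite /= in_itv /= ler01 lexx.
    by rewrite !mul1r !(addrC _ (_ - _)) !subrK; case: (x).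
  rewrite /= in_itv /= /disc /sqdist /= in dx * => t01.
  by rewrite !(addrC c.1) !(addrC c.2) !addrK !exprMn -mulrDr; nra.
apply: bigcup_connected.
  exists c => x _; exists 0; first by rewrite /= in_itv /= ler01 lexx.
  by rewrite !mul0r !addr0; case: (c).
move=> x _; apply: connected_continuous_connected; first exact: segment_connected.
by apply: continuous_subspaceT; exact: continuous_line.
Qed.

Lemma open_lt_sqdist c : open [set x | sqdist x c < 1].
Proof.
have /continuousP/(_ _ (@open_lt R 1)) := @continuous_sqdist c.
exact.
Qed.

Lemma boundary_disc c : boundary (disc c) = [set x | sqdist x c = 1].
Proof.
rewrite /boundary -(proj1 (closure_id _) (@closed_disc c)).
apply/seteqP; split => x /=.
  move=> [dx nx]; apply/eqP; rewrite eq_le dx /= leNgt; apply/negP => lx.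
  have : [set y | sqdist y c < 1] `<=` (disc c)°.
    by rewrite -open_subsetE; [move=> y /= /ltW|exact: open_lt_sqdist].
  by move=> /(_ _ lx).
move=> sx; split; first by rewrite /disc /= sx.
(* a boundary point pushed radially outwards leaves the disc *)
pose out (t : R) := (x.1 + t * (x.1 - c.1), x.2 + t * (x.2 - c.2)).
have outx : out t @[t --> (0:R)^'+] --> x.
  rewrite [X in _ --> X](_ : _ = (x.1 + 0 * (x.1 - c.1), x.2 + 0 * (x.2 - c.2))); last first.
    by rewrite !mul0r !addr0; case: (x).
  by apply: cvg_at_right_filter; exact: continuous_line.
move=> /outx nd.
near (0:R)^'+ => t.
have : disc c (out t) by near: t.
have t0 : 0 < t by near: t; exact: nbhs_right_gt.
rewrite /disc /sqdist /out /=; move: sx; rewrite /sqdist => sx; nra.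
Unshelve. all: by end_near.
Qed.

End Disc.

(** * The circle as an analytic curve *)

Section Circle.
Variable R : realType.
Implicit Types (c x p : R * R).

Lemma derive1_trig (a b d t : R) :
  derive1 (fun t => a + (b * cos t + d * sin t)) t = d * cos t - b * sin t.
Proof.
rewrite derive1E; apply: (@derive_val _ _ _ _ _ _ _ _).
apply: is_derive_eq; rewrite /GRing.scale /=; ring.
Qed.

(** Around a point p the circle is parametrized by the angle measured from p.
    In the orthonormal frame made of the unit radius at p and its rotation by a
    right angle, a point has coordinates [rad] and [tng], which are the cosine
    and the sine of that angle. On the open half plane [rad] > 0 the angle is
    therefore the arcsine of [tng], continuous because |[tng]| < 1 there. *)
Lemma analytic_curve_circle c : analytic_curve [set x | sqdist x c = 1].
Proof.
move=> p /=; rewrite /sqdist.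
set u := p.1 - c.1; set v := p.2 - c.2 => uv1.
pose rad x := u * x.1 + v * x.2 + - (u * c.1 + v * c.2).
pose tng x := - v * x.1 + u * x.2 + (v * c.1 - u * c.2).
have rad_tng x : rad x ^+ 2 + tng x ^+ 2 = sqdist x c.
  rewrite -[RHS]mul1r -uv1 /rad /tng /sqdist; ring.
pose gam t := (c.1 + (u * cos t + - v * sin t), c.2 + (v * cos t + u * sin t)).
have rad_gam t : rad (gam t) = cos t.
  rewrite -[RHS]mul1r -uv1 /rad /gam /=; ring.
have tng_gam t : tng (gam t) = sin t.
  rewrite -[RHS]mul1r -uv1 /tng /gam /=; ring.
have tng_lt1 x : rad x ^+ 2 + tng x ^+ 2 = 1 -> 0 < rad x -> -1 < tng x < 1.
  move=> sx rx; rewrite -ltr_norml -(@expr_lt1 _ 2) // real_normK ?num_real //.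
  by rewrite -sx ltrDr exprn_gt0.
exists [set x | 0 < rad x], `]- (pi / 2), pi / 2[%classic, gam,
  (fun x => asin (tng x)).
split; split.
- by have /continuousP/(_ _ (@open_gt R 0)) :=
    @continuous_affine R u v (- (u * c.1 + v * c.2)).
- rewrite /= (_ : rad p = 1) ?ltr01 // -uv1 /rad /u /v; ring.
- exact: interval_open.
- by move=> t _; split; exact: real_analytic_at_trig.
- move=> t _; apply/eqP => -[].
  rewrite (derive1_trig c.1 u (- v)) (derive1_trig c.2 v u) => d1 d2.
  have : (u ^+ 2 + v ^+ 2) * (cos t ^+ 2 + sin t ^+ 2) = 1.
    by rewrite uv1 cos2Dsin2 mulr1.
  rewrite (_ : _ * _ = (- v * cos t - u * sin t) ^+ 2
    + (u * cos t - v * sin t) ^+ 2); last by ring.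
  by rewrite d1 d2 expr0n addr0 => /esym/eqP; rewrite oner_eq0.
- apply/seteqP; split => [_ [t + <-]|x [/= sx rx]].
    rewrite /= in_itv /= => tI; split; last by rewrite /= rad_gam cos_gt0_pihalf.
    by rewrite /= -/(sqdist (gam t) c) -rad_tng rad_gam tng_gam cos2Dsin2.
  rewrite -/(sqdist x c) -rad_tng in sx.
  have /andP[tx1 tx2] := tng_lt1 _ sx rx.
  have tx1' := ltW tx1; have tx2' := ltW tx2.
  exists (asin (tng x)).
    by rewrite /= in_itv /= asin_gtNpi2 ?asin_ltpi2 ?tx1 ?tx1'.
  have sa : sin (asin (tng x)) = tng x.
    by apply: asinK; rewrite in_itv /= tx1'.
  have ca : cos (asin (tng x)) = rad x.
    rewrite cos_asin ?tx1' //.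
    by rewrite -sx addrK sqrtr_sqr gtr0_norm.
  rewrite /gam sa ca [RHS]surjective_pairing; congr pair.
    transitivity (c.1 + (u^+2 + v^+2) * (x.1 - c.1)).
      rewrite /rad /tng; ring.
    by rewrite uv1 mul1r addrC subrK.
  transitivity (c.2 + (u^+2 + v^+2) * (x.2 - c.2)).
    rewrite /rad /tng; ring.
  by rewrite uv1 mul1r addrC subrK.
- move=> t; rewrite /= in_itv /= => tI; rewrite tng_gam sinK // in_itv /=.
  by rewrite !ltW //; case/andP: tI.
- apply: continuous_in_subspaceT => x /set_mem [/= sx rx].
  rewrite -/(sqdist x c) -rad_tng in sx.
  apply: (@continuous_comp _ _ _ tng asin); first exact: continuous_affine.
  exact: continuous_asin (tng_lt1 _ sx rx).
Qed.

Lemma classC_disc c : classC (disc c).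
Proof.
split; [|exact: compact_disc|exact: connected_disc|].
  by exists c; rewrite /disc /sqdist /= !subrr expr0n addr0 ler01.
by rewrite boundary_disc; exact: analytic_curve_circle.
Qed.

End Circle.

(** * Hausdorff distance of two unit discs *)

Section Hausdorff.
Variable R : realType.
Implicit Types (a b x : R * R).

Lemma disc_translate a b x : disc a x -> disc b (x + (b - a)).
Proof.
rewrite /disc /sqdist /=; congr (_ <= _); congr (_ ^+ 2 + _ ^+ 2); ring.
Qed.

Lemma dist_to_disc_bounds a b x :
  disc a x -> 0 <= dist_to_set x (disc b) <= edist2 a b.
Proof.
move=> ax; apply/andP; split.
  apply: lb_le_inf; last by move=> _ [y _ <-]; exact: sqrtr_ge0.
  by exists (edist2 x (x + (b - a))); exists (x + (b - a)) => //; exact: disc_translate ax.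
apply: ge_inf; first by exists 0 => _ [y _ <-]; exact: sqrtr_ge0.
exists (x + (b - a)); first exact: disc_translate ax.
rewrite /edist2 /=; congr (Num.sqrt (_ ^+ 2 + _ ^+ 2)); ring.
Qed.

Lemma sup_dist_to_disc_bounds a b :
  0 <= sup [set dist_to_set x (disc b) | x in disc a] <= edist2 a b.
Proof.
have aa : disc a a by rewrite /disc /sqdist /= !subrr expr0n addr0 ler01.
apply/andP; split; last first.
  apply: ge_sup; first by exists (dist_to_set a (disc b)); exists a.
  by move=> _ [x ax <-]; case/andP: (dist_to_disc_bounds b ax).
apply: (@le_trans _ _ (dist_to_set a (disc b))).
  by case/andP: (dist_to_disc_bounds b aa).
apply: ub_le_sup; last by exists a.
by exists (edist2 a b) => _ [x ax <-]; case/andP: (dist_to_disc_bounds b ax).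
Qed.

Lemma hausdorff_dist_disc a b :
  0 <= hausdorff_dist (disc a) (disc b) <= edist2 a b.
Proof.
have /andP[l1 u1] := sup_dist_to_disc_bounds a b.
have /andP[l2 u2] := sup_dist_to_disc_bounds b a.
rewrite /hausdorff_dist le_max l1 ge_max u1 /=.
suff -> : edist2 a b = edist2 b a by [].
rewrite /edist2; congr (Num.sqrt (_ + _)); ring.
Qed.

End Hausdorff.

(** * Area of the overlap of two unit discs *)

Section Overlap.
Variable R : realType.
Implicit Types (a b x : R * R).
Local Notation area := (@area R).

Lemma area_setX (A B : set R) : measurable A -> measurable B ->
  area (A `*` B) = (lebesgue_measure A * lebesgue_measure B)%E.
Proof. by move=> mA mB; exact: product_measure1E. Qed.

(** By the parallelogram law a common point is within squared distance
    1 - |a - b|^2 / 4 <= 0 of the midpoint of the centres, so the intersection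
    has at most one point. *)
Lemma area0_discs a b : 4 <= sqdist a b -> area (disc a `&` disc b) = 0%E.
Proof.
move=> ab4; pose m1 := (a.1 + b.1) / 2; pose m2 := (a.2 + b.2) / 2.
have sub : disc a `&` disc b `<=` [set m1] `*` [set m2].
  move=> x [ax bx].
  have : sqdist x (m1, m2) <= 0.
    have -> : sqdist x (m1, m2) = (sqdist x a + sqdist x b) / 2 - sqdist a b / 4.
      by rewrite /sqdist /m1 /m2 /=; field.
    have ax1 : sqdist x a <= 1 by [].
    have bx1 : sqdist x b <= 1 by [].
    by lra.
  rewrite /sqdist /= => le0.
  have : (x.1 - m1) ^+ 2 + (x.2 - m2) ^+ 2 == 0.
    by rewrite eq_le le0 addr_ge0 ?sqr_ge0.
  by rewrite paddr_eq0 ?sqr_ge0 // !sqrf_eq0 !subr_eq0 => /andP[/eqP -> /eqP ->].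
apply/eqP; rewrite eq_le measure_ge0 andbT.
have <- : area ([set m1] `*` [set m2]) = 0%E.
  by rewrite area_setX // lebesgue_measure_set1 mul0e.
apply: le_measure => //; rewrite inE.
  by apply: measurableI; exact: measurable_disc.
exact: measurableX.
Qed.

(** The midpoint of the centres is interior to both discs, so a small square
    around it lies in the intersection. *)
Lemma area_gt0_discs a b : sqdist a b < 4 -> (0 < area (disc a `&` disc b))%E.
Proof.
move=> ab4; pose m1 := (a.1 + b.1) / 2; pose m2 := (a.2 + b.2) / 2.
pose h1 := (a.1 - b.1) / 2; pose h2 := (a.2 - b.2) / 2.
have hq : h1 ^+ 2 + h2 ^+ 2 = sqdist a b / 4.
  by rewrite /h1 /h2 /sqdist; field.
(* For offsets r, s of size at most e <= 1, moving by (r, s) changes the squared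
   distance to a centre by at most r^2 + s^2 + 2 |r| + 2 |s| <= 6 e, less than
   the available room 1 - |a - b|^2 / 4 = 8 e. *)
pose e := (1 - sqdist a b / 4) / 8.
have e0 : 0 < e by rewrite /e; lra.
have ab0 : 0 <= sqdist a b by rewrite addr_ge0 ?sqr_ge0.
have h1b : `|h1| <= 1.
  by rewrite -sqr_norm_le1; have := sqr_ge0 h2; lra.
have h2b : `|h2| <= 1.
  by rewrite -sqr_norm_le1; have := sqr_ge0 h1; lra.
have near_centre (k1 k2 r s : R) : k1 ^+ 2 + k2 ^+ 2 = sqdist a b / 4 ->
    `|k1| <= 1 -> `|k2| <= 1 -> `|r| <= e -> `|s| <= e -> (r + k1) ^+ 2 + (s + k2) ^+ 2 <= 1.
  move=> kq k1b k2b rb sb.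
  have r2 : r ^+ 2 <= e.
    rewrite -real_normK ?num_real // expr2; apply: le_trans (ler_pM _ _ rb rb) _ => //.
    by rewrite -[leRHS]mulr1 ler_pM2l // /e; lra.
  have s2 : s ^+ 2 <= e.
    rewrite -real_normK ?num_real // expr2; apply: le_trans (ler_pM _ _ sb sb) _ => //.
    by rewrite -[leRHS]mulr1 ler_pM2l // /e; lra.
  have rk : r * k1 <= e.
    apply: le_trans (ler_norm _) _; rewrite normrM -[leRHS]mulr1.
    exact: ler_pM.
  have sk : s * k2 <= e.
    apply: le_trans (ler_norm _) _; rewrite normrM -[leRHS]mulr1.
    exact: ler_pM.
  have -> : (r + k1) ^+ 2 + (s + k2) ^+ 2 =
    r ^+ 2 + s ^+ 2 + 2 * (r * k1) + 2 * (s * k2) + (k1 ^+ 2 + k2 ^+ 2) by ring.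
  rewrite kq; move: r2 s2 rk sk; rewrite /e; lra.
pose box := (`[m1 - e, m1 + e]%classic `*` `[m2 - e, m2 + e]%classic) : set (R * R).
have sub : box `<=` disc a `&` disc b.
  move=> x [/=]; rewrite !in_itv /= -!ler_distl => x1 x2; split.
    rewrite /disc /sqdist /=.
    have -> : x.1 - a.1 = (x.1 - m1) + - h1 by rewrite /m1 /h1; field.
    have -> : x.2 - a.2 = (x.2 - m2) + - h2 by rewrite /m2 /h2; field.
    by apply: near_centre; rewrite ?sqrrN ?normrN.
  rewrite /disc /sqdist /=.
  have -> : x.1 - b.1 = (x.1 - m1) + h1 by rewrite /m1 /h1; field.
  have -> : x.2 - b.2 = (x.2 - m2) + h2 by rewrite /m2 /h2; field.
  exact: near_centre.
have : (0 < area box)%E.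
  rewrite area_setX // !lebesgue_measure_itv /= !lte_fin.
  rewrite !ifT; [|lra|lra].
  by rewrite -!EFinB -EFinM lte_fin mulr_gt0 //; lra.
move=> /lt_le_trans; apply.
apply: le_measure => //; rewrite inE; first exact: measurableX.
by apply: measurableI; exact: measurable_disc.
Qed.

End Overlap.

(** * Rigid motions and closest approach *)

Section Motion.
Variable R : realType.
Implicit Types (c x p beta : R * R) (V : velocity R).
Local Notation mu := (@lebesgue_measure R).
Local Notation rot := (@Defs.rot R).

Lemma rot0 th : rot th (0 : R * R) = 0.
Proof. by rewrite /Defs.rot /= !mulr0 subrr addr0. Qed.

Lemma rot_id x : rot 0 x = x.
Proof. by rewrite /Defs.rot cos0 sin0 !mul1r !mul0r subr0 add0r; case: x. Qed.

Lemma rotVK th x : rot th (rot (- th) x) = x.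
Proof.
rewrite /Defs.rot cosN sinN /= [RHS]surjective_pairing; congr pair.
  rewrite -[RHS]mul1r -(cos2Dsin2 th); ring.
rewrite -[RHS]mul1r -(cos2Dsin2 th); ring.
Qed.

Lemma sqdist_move th (y p c : R * R) :
  sqdist (rot th p + y) (rot th c + y) = sqdist p c.
Proof. rewrite -[RHS]mul1r -(cos2Dsin2 th) /sqdist /Defs.rot /=; ring. Qed.

Lemma move_disc th (y c : R * R) : move th y (disc c) = disc (rot th c + y).
Proof.
apply/seteqP; split => [_ [p pc <-]|x xc].
  by rewrite /disc /= sqdist_move.
have xE : rot th (rot (- th) (x - y)) + y = x by rewrite rotVK subrK.
exists (rot (- th) (x - y)) => //.
by rewrite /disc /= -(sqdist_move th y) xE.
Qed.

(** When the rotation fixes the centre, the moved disc is the disc shifted by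
    the vector of length d, so overlap stops exactly at d = 2. *)
Lemma closest_approach_disc c beta :
  rot beta.1 c = c -> closest_approach (disc c) beta = 2.
Proof.
move=> fixc.
have dE (d : R) : sqdist c (c + polar d beta.2) = d ^+ 2.
  by rewrite -[RHS]mulr1 -(cos2Dsin2 beta.2) /sqdist /polar /=; ring.
rewrite /closest_approach (_ : [set d | _] = `[2, +oo[%classic).
  by rewrite inf_itv.
apply/seteqP; split => d /=; rewrite move_disc fixc in_itv /= andbT.
  move=> [d0 a0]; rewrite leNgt; apply/negP => d2.
  suff : (0 < area (disc c `&` disc (c + polar d beta.2)%R))%E.
    by rewrite a0 ltxx.
  by apply: area_gt0_discs; rewrite dE; nra.
move=> d2; split; first by lra.
by apply: area0_discs; rewrite dE; nra.
Qed.

(** * Primitives of constant velocities *)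

Lemma ae_imply (P Q : R -> Prop) : (forall s, P s -> Q s) ->
  {ae mu, forall s, P s} -> {ae mu, forall s, Q s}.
Proof.
move=> PQ; apply: (@filterS _ _ (ae_filter_ringOfSetsType mu)); exact: PQ.
Qed.

Lemma Rintegral_ae_cst (D : set R) (f : R -> R) (k : R) :
  measurable D -> measurable_fun setT f -> {ae mu, forall s, f s = k} ->
  \int[mu]_(s in D) f s = k * fine (mu D).
Proof.
move=> mD mf fk; rewrite -(Rintegral_cst mu mD k) /Rintegral; congr fine.
apply: ae_eq_integral => //.
- by apply/measurable_EFinP; exact: measurable_funTS.
- by apply: ae_imply fk => s /= -> _.
Qed.

Lemma int0_ae_cst (f : R -> R) (k t : R) :
  measurable_fun setT f -> {ae mu, forall s, f s = k} -> int0 f t = k * t.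
Proof.
move=> mf fk; rewrite /int0 !(Rintegral_ae_cst _ mf fk) //.
rewrite !lebesgue_measure_itv /= !lte_fin.
by case: ltgtP => [t0|t0|<-]; rewrite ?mulr0 /= ?subr0 ?sub0r ?add0r ?mulrN ?opprK ?mulr0.
Qed.

Lemma primitive_ae_cst V (k : 'I_6) (t : R) (v : 'rV[R]_6) :
  L1loc V -> {ae mu, forall s, V s = v} -> primitive V k t = v ord0 k * t.
Proof.
move=> LV Vv; apply: int0_ae_cst; first by case: (LV k).
by apply: ae_imply Vv => s ->.
Qed.

Lemma L1loc_cst (v : 'rV[R]_6) : L1loc (fun _ => v).
Proof.
move=> k; split; [exact: measurable_cst|exact: openT|move=> K _ cK].
rewrite integral_cst; last exact: compact_measurable.
by rewrite lte_mul_pinfty ?lee_fin // compact_finite_measure.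
Qed.

(** * Constant velocities for centred and shifted discs *)

Lemma cos_lt1 (t : R) : t != 0 -> - 1 < t < 1 -> cos t < 1.
Proof.
wlog t0 : t / 0 < t => [hw tn0 /andP[t1 t2]|_ /andP[_ t1]].
  have [t0|t0] := ltP 0 t; first by apply: hw => //; rewrite t1 t2.
  rewrite -cosN; apply: hw; rewrite ?oppr_eq0 ?oppr_gt0 ?lt_neqAle ?tn0 //=.
  by apply/andP; split; lra.
rewrite lt_neqAle cos_le1 andbT; apply/eqP => c1.
have : 0 < sin t by apply: sin_gt0_pi; have := pi_ge2 R; lra.
by rewrite cos1sin0 ?ltxx // c1 normr1.
Qed.

(** Rotations leave the centred disc in place, so only the relative linear
    velocity w counts; along w the squared distance of the centres is a convex
    function of t, and it cannot drop below its value 4 at t = 0 on both sides. *)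
Lemma inadmissible_germs_disc0 beta :
  inadmissible_germs (disc (0 : R * R)) (constF R) beta = set0.
Proof.
apply/seteqP; split => // _ [V [[LV [v Vv]] [_ [a [b [a0 b0 pos]]]]] _] /=.
pose w1 := v ord0 (@Ordinal 6 2 isT) - v ord0 (@Ordinal 6 0 isT).
pose w2 := v ord0 (@Ordinal 6 3 isT) - v ord0 (@Ordinal 6 1 isT).
pose we := w1 * cos beta.2 + w2 * sin beta.2.
(* A time inside the interval on the side where the centres do not approach
   to first order. *)
have [t [tab t0 tw]] : exists t, [/\ a < t < b, t != 0 & 0 <= t * we].
  have [we0|we0] := leP 0 we.
    exists (b / 2); split; [lra|by rewrite gt_eqF //; lra|by rewrite mulr_ge0 //; lra].
  exists (a / 2); split; [lra|by rewrite lt_eqF //; lra|by rewrite mulr_le0 //; lra].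
suff : area (particle (disc 0) V t `&` particle_bar (disc 0) beta V t) = 0%E.
  by move=> a0t; have := pos t tab t0; rewrite a0t ltxx.
rewrite /particle /particle_bar closest_approach_disc ?rot0 // !move_disc !rot0 !add0r.
apply: area0_discs; rewrite !(primitive_ae_cst _ _ LV Vv) /sqdist /polar /=.
rewrite [leRHS](_ : _ = 4 * (cos beta.2 ^+ 2 + sin beta.2 ^+ 2) + 4 * (t * we)
   + t ^+ 2 * (w1 ^+ 2 + w2 ^+ 2)); last by rewrite /we /w1 /w2; ring.
have : 0 <= t ^+ 2 * (w1 ^+ 2 + w2 ^+ 2).
  by rewrite mulr_ge0 ?addr_ge0 ?sqr_ge0.
rewrite cos2Dsin2; lra.
Qed.

Lemma torus2_00 : torus2 (0, 0 : R).
Proof. by rewrite /torus2 /= lexx mulr_gt0 ?pi_gt0. Qed.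

(** Entry 5 is the angular velocity of the second particle. *)
Definition spin_bar : velocity R := fun _ => delta_mx ord0 (@Ordinal 6 5 isT).

(** The second centre turns on a circle of radius s and so moves along a chord
    of squared length 2 s^2 (1 - cos t), whose component towards the first centre
    is s (1 - cos t). The latter lowers the squared distance by 4 s (1 - cos t),
    which outweighs the former since s <= 1. *)
Lemma spin_bar_inadmissible (s : R) : 0 < s <= 1 ->
  inadmissible (disc (s, 0)) (0, 0) spin_bar.
Proof.
move=> /andP[s0 s1]; split; first exact: L1loc_cst.
exists (- 1), 1; split; [lra|lra|move=> t t1 t0].
have prim k : primitive spin_bar k t = (k == @Ordinal 6 5 isT)%:R * t.
  rewrite (primitive_ae_cst k t (L1loc_cst _) (aeW _ (fun _ => erefl))).
  by rewrite mxE eqxx.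
rewrite /particle /particle_bar closest_approach_disc ?rot_id // !move_disc !prim /=.
rewrite !mul0r mul1r add0r rot_id; apply: area_gt0_discs.
rewrite /sqdist /Defs.rot /polar cos0 sin0 /=.
rewrite [ltLHS](_ : _ = 4 - (4 * s) * (1 - cos t)
  + s ^+ 2 * (cos t ^+ 2 + sin t ^+ 2 + 1 - 2 * cos t)); last by ring.
rewrite cos2Dsin2.
have sc0 : 0 < s * (1 - cos t) by rewrite mulr_gt0 // subr_gt0 cos_lt1.
have : 0 <= s * (1 - cos t) * (1 - s) by rewrite mulr_ge0 ?(ltW sc0) // subr_ge0.
lra.
Qed.

End Motion.

(** * Instability *)

Theorem theorem1p1 (R : realType) :
  exists (Pstar : set (R * R)) (P : nat -> set (R * R)),
    [/\ classC Pstar,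
        forall j, classC (P j) &
        hausdorff_dist (P j) Pstar @[j --> \oo] --> (0 : R)] /\
    (forall j, inadmissible_class (P j) (constF R) <> [set set0]) /\
    inadmissible_class Pstar (constF R) = [set set0].
Proof.
exists (disc 0), (fun j => disc (j.+1%:R^-1, 0)); split; [split|split].
- exact: classC_disc.
- by move=> j; exact: classC_disc.
- apply: (squeeze_cvgr _ (cvg_cst 0) (@cvg_harmonic R)); near=> j.
  have -> : harmonic j = edist2 (j.+1%:R^-1, 0) (0 : R * R).
    by rewrite /edist2 /= !subr0 expr0n addr0 sqrtr_sqr ger0_norm.
  exact: hausdorff_dist_disc.
- move=> j eq0.
  have Vin : (constF R `&` inadmissible (disc (j.+1%:R^-1, 0)) (0, 0)) (@spin_bar R).
    split; first split.
    + exact: L1loc_cst.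
    + by exists (delta_mx ord0 (@Ordinal 6 5 isT)); exact: aeW.
    + by apply: spin_bar_inadmissible; rewrite invr_gt0 ltr0n /= invf_le1 ?ltr0n // ler1n.
  have : inadmissible_class (disc (j.+1%:R^-1, 0)) (constF R)
      (inadmissible_germs (disc (j.+1%:R^-1, 0)) (constF R) (0, 0)).
    by exists (0, 0); first exact: torus2_00.
  rewrite eq0 /= => germs0.
  have : set0 (germ0 (@spin_bar R)) by rewrite -germs0; exists (@spin_bar R).
  by [].
- apply/seteqP; split => [_ [beta _ <-]|_ ->] /=.
    exact: inadmissible_germs_disc0.
  exists (0, 0); first exact: torus2_00.
  exact: inadmissible_germs_disc0.
Unshelve. all: by end_near.
Qed.
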